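(* Consider the problem $\min_{\mathbf{x},\mathbf{z}}F(\mathbf{x})+H(\mathbf{z})$ subject to $\mathbf{A}\mathbf{x}+\mathbf{B}\mathbf{z}=\mathbf{c}$, with $F=F^0+F^1$ and $H=H^0+H^1$. Suppose that the problem is feasible and its set of stationary points is nonempty; that $F$ and $H$ are bounded from below and coercive, $F^0$ and $H^0$ are differentiable with $L_F$- and $L_H$-Lipschitz gradients ($L_F,L_H>0$), and $F^1$ and $H^1$ are proper, closed, and $\gamma_F$- and $\gamma_H$-weakly convex; and that the parameters $\rho,\beta,\tau_F,\tau_H,d$ satisfy $\rho>0$, $\beta>0$, $0<\rho\beta<1$, $d>\frac{(1-\rho\beta)(2-\rho\beta)}{4\rho\beta}>0$, $\tau_F\mathbf{I}\succ 2d\rho\mathbf{A}^\top\mathbf{A}+[(4d+3)L_F+(4d+1)\gamma_F]\mathbf{I}$, $\tau_H\mathbf{I}\succ 8d\rho\mathbf{B}^\top\mathbf{B}+[(4d+3)L_H+(4d+1)\gamma_H]\mathbf{I}$, $\tau_F\mathbf{I}\succ\rho\mathbf{A}^\top\mathbf{A}$, $\tau_H\mathbf{I}\succ\rho\mathbf{B}^\top\mathbf{B}$, $\tau_F>\gamma_F$, $\tau_H>\gamma_H$. Then the sequence $\{(\mathbf{x}^k,\mathbf{z}^k,\bm{\lambda}^k)\}_{k\geqslant0}$ generated by the PPG-ADMM iteration described in the context is bounded, and the Lyapunov function $\mathcal{P}$ is sufficiently decreasing and bounded from below along $\{\bm{\omega}^{k+1}\}_{k\geqslant 0}$. Moreover,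 the successive differences of the iterates vanish asymptotically: $\Vert\mathbf{x}^{k+1}-\mathbf{x}^k\Vert\to0$, $\Vert\mathbf{z}^{k+1}-\mathbf{z}^k\Vert\to0$ and $\Vert\bm{\lambda}^{k+1}-\bm{\lambda}^k\Vert\to0$ as $k\to+\infty$.
   Context: **Problem.** $\min_{\mathbf{x}\in\mathbb{R}^n,\mathbf{z}\in\mathbb{R}^m} F(\mathbf{x})+H(\mathbf{z})$ subject to $\mathbf{A}\mathbf{x}+\mathbf{B}\mathbf{z}=\mathbf{c}$, where $\mathbf{A}\in\mathbb{R}^{p\times n}$, $\mathbf{B}\in\mathbb{R}^{p\times m}$, $\mathbf{c}\in\mathbb{R}^p$, $F=F^0+F^1$, $H=H^0+H^1$, with $F^0:\mathbb{R}^n\to\mathbb{R}$, $H^0:\mathbb{R}^m\to\mathbb{R}$, $F^1:\mathbb{R}^n\to\mathbb{R}\cup\{+\infty\}$, $H^1:\mathbb{R}^m\to\mathbb{R}\cup\{+\infty\}$. **Notation.** $\Vert\cdot\Vert$ is the Euclidean norm; $\Vert \mathbf{y}\Vert_{\mathbf{M}}^2=\langle \mathbf{y},\mathbf{M}\mathbf{y}\rangle$ for symmetric $\mathbf{M}$; $\mathbf{M}\succ\mathbf{N}$ means $\mathbf{M}-\mathbf{N}$ is positive definite. A function $g$ is coercive if $g(x)\to\infty$ as $\Vert x\Vert\to\infty$; $g$ is $\gamma$-weakly convex, $\gamma\geqslant0$, if $g+\frac{\gamma}{2}\Vert\cdot\Vert^2$ is convex. A stationary point of the problem is $(\mathbf{x}^*,\mathbf{z}^*,\bm{\lambda}^*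 )$ with $\mathbf{0}\in\nabla F^0(\mathbf{x}^* )+\partial F^1(\mathbf{x}^* )-\mathbf{A}^\top\bm{\lambda}^*$, $\mathbf{0}\in\nabla H^0(\mathbf{z}^* )+\partial H^1(\mathbf{z}^* )-\mathbf{B}^\top\bm{\lambda}^*$, $\mathbf{A}\mathbf{x}^*+\mathbf{B}\mathbf{z}^*=\mathbf{c}$ ($\partial$ is the limiting subdifferential). The parameter $d>0$ is the coefficient appearing in $\mathcal{P}$ below. **PPG-ADMM iteration.** Let $\mathbf{P}=\tau_F\mathbf{I}-\rho\mathbf{A}^\top\mathbf{A}$ and $\mathbf{Q}=\tau_H\mathbf{I}-\rho\mathbf{B}^\top\mathbf{B}$. Given arbitrary $\mathbf{x}^0\in\mathbb{R}^n,\mathbf{z}^0\in\mathbb{R}^m,\bm{\lambda}^0\in\mathbb{R}^p$, for $k\geqslant0$: $$\mathbf{x}^{k+1}=\arg\min_{\mathbf{x}}\Big\{\langle\nabla F^0(\mathbf{x}^k),\mathbf{x}\rangle+F^1(\mathbf{x})+\tfrac{\rho}{2}\Vert\mathbf{A}\mathbf{x}+\mathbf{B}\mathbf{z}^k-\mathbf{c}\Vert^2-\langle(1-\rho\beta)\bm{\lambda}^k,\mathbf{A}\mathbf{x}+\mathbf{B}\mathbf{z}^k-\mathbf{c}\rangle+\tfrac12\Vert\mathbf{x}-\mathbf{x}^k\Vert_{\mathbf{P}}^2\Big\},$$ $$\mathbf{z}^{k+1}=\arg\min_{\mathbf{z}}\Big\{\langle\nabla H^0(\mathbf{z}^k),\mathbf{z}\rangle+H^1(\mathbf{z})+\tfrac{\rho}{2}\Vert\mathbf{A}\mathbf{x}^{k+1}+\mathbf{B}\mathbf{z}-\mathbf{c}\Vert^2-\langle(1-\rho\beta)\bm{\lambda}^k,\mathbf{A}\mathbf{x}^{k+1}+\mathbf{B}\mathbf{z}-\mathbf{c}\rangle+\tfrac12\Vert\mathbf{z}-\mathbf{z}^k\Vert_{\mathbf{Q}}^2\Big\},$$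 $$\bm{\lambda}^{k+1}=(1-\rho\beta)\bm{\lambda}^k-\rho(\mathbf{A}\mathbf{x}^{k+1}+\mathbf{B}\mathbf{z}^{k+1}-\mathbf{c}).$$ **Lyapunov function.** Put $\bm{\omega}^{k+1}=(\mathbf{x}^{k+1},\mathbf{z}^{k+1},\bm{\lambda}^{k+1},\mathbf{x}^k,\mathbf{z}^k)$ for $k\geqslant0$, $$L_{\rho\beta}(\mathbf{x},\mathbf{z},\bm{\lambda})=F(\mathbf{x})+H(\mathbf{z})-\langle(1-\rho\beta)\bm{\lambda},\mathbf{A}\mathbf{x}+\mathbf{B}\mathbf{z}-\mathbf{c}\rangle+\tfrac{\rho}{2}\Vert\mathbf{A}\mathbf{x}+\mathbf{B}\mathbf{z}-\mathbf{c}\Vert^2,$$ $$\mathcal{T}(\mathbf{x},\mathbf{z},\bm{\lambda},\mathbf{x}',\mathbf{z}')=L_{\rho\beta}(\mathbf{x},\mathbf{z},\bm{\lambda})+\tfrac12\Vert\mathbf{x}-\mathbf{x}'\Vert_{\mathbf{P}}^2+\tfrac12\Vert\mathbf{z}-\mathbf{z}'\Vert_{\mathbf{Q}}^2-\tfrac{\beta}{2}(1-\rho\beta)\Vert\bm{\lambda}\Vert^2,$$ $$\mathcal{P}(\bm{\omega}^{k+1})=\mathcal{T}(\bm{\omega}^{k+1})+d\Big[\Vert\mathbf{x}^{k+1}-\mathbf{x}^k\Vert^2_{L_F\mathbf{I}+\mathbf{P}}+\Vert\mathbf{z}^{k+1}-\mathbf{z}^k\Vert^2_{L_H\mathbf{I}+\mathbf{Q}+2\rho\mathbf{B}^\top\mathbf{B}}+\tfrac{1-\rho\beta}{\rho}\Vert\bm{\lambda}^{k+1}-\bm{\lambda}^k\Vert^2\Big].$$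 ''Sufficiently decreasing'' means: there are nonnegative coefficients $a_1,a_2,a_3$ such that for all $k\geqslant1$, $\mathcal{P}(\bm{\omega}^{k+1})-\mathcal{P}(\bm{\omega}^k)\leqslant-a_1\Vert\mathbf{x}^{k+1}-\mathbf{x}^k\Vert^2-a_2\Vert\mathbf{z}^{k+1}-\mathbf{z}^k\Vert^2-a_3\Vert\bm{\lambda}^{k+1}-\bm{\lambda}^k\Vert^2$. ''Bounded from below'' means $\inf_{k\geqslant 0}\mathcal{P}(\bm{\omega}^{k+1})>-\infty$. *)

(* Defs.v *)
From HB Require Import structures.
From mathcomp Require Import all_boot all_order all_algebra.
From mathcomp Require Import all_classical all_reals all_analysis.

Set Implicit Arguments.
Unset Strict Implicit.
Unset Printing Implicit Defensive.

Import Order.TTheory GRing.Theory Num.Theory.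
Import numFieldNormedType.Exports.

Local Open Scope classical_set_scope.
Local Open Scope ring_scope.

Definition inner (R : realType) (n : nat) (u v : 'cV[R]_n) : R :=
  \sum_(i < n) u i 0 * v i 0.

(* The library norm `|u| on 'cV[R]_n is the sup norm; it induces the same
   topology, so convergence, differentiability and semicontinuity below are
   taken from the library, while every metric quantity uses enorm. *)
Definition enorm (R : realType) (n : nat) (u : 'cV[R]_n) : R :=
  Num.sqrt (inner u u).

Definition wnorm2 (R : realType) (n : nat) (M : 'M[R]_n) (y : 'cV[R]_n) : R :=
  inner y (M *m y).

Definition posdef (R : realType) (n : nat) (M : 'M[R]_n) : Prop :=
  M^T = M /\ forall y : 'cV[R]_n, y != 0 -> 0 < inner y (M *m y).

Definition mx_succ (R : realType) (n : nat) (M N : 'M[R]_n) : Prop :=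
  posdef (M - N).

Definition grad (R : realType) (n : nat) (f : 'cV[R]_n -> R) (x : 'cV[R]_n) :
    'cV[R]_n :=
  \col_(i < n) 'D_(delta_mx i 0) f x.

Definition lipschitz_gradient (R : realType) (n : nat) (f : 'cV[R]_n -> R)
    (L : R) : Prop :=
  (forall x, differentiable f x) /\
  (forall x y, enorm (grad f x - grad f y) <= L * enorm (x - y)).

Definition proper_fun (R : realType) (n : nat) (g : 'cV[R]_n -> \bar R) : Prop :=
  (forall x, g x != -oo%E) /\ (exists x, g x != +oo%E).

(* Only used for proper g: no -oo value occurs, and 0 * +oo = 0. *)
Definition econvex (R : realType) (n : nat) (g : 'cV[R]_n -> \bar R) : Prop :=
  forall (x y : 'cV[R]_n) (t : R), 0 <= t <= 1 ->
    (g (t *: x + (1 - t) *: y)%R <= t%:E * g x + (1 - t)%R%:E * g y)%E.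

Definition weakly_convex (R : realType) (n : nat) (gamma : R)
    (g : 'cV[R]_n -> \bar R) : Prop :=
  0 <= gamma /\
  econvex (fun x => g x + (gamma / 2 * enorm x ^+ 2)%R%:E)%E.

Definition bounded_below (R : realType) (n : nat) (g : 'cV[R]_n -> \bar R) :
    Prop :=
  exists M : R, forall x, (M%:E <= g x)%E.

Definition coercive (R : realType) (n : nat) (g : 'cV[R]_n -> \bar R) : Prop :=
  forall M : R, exists r : R, forall x, r <= enorm x -> (M%:E <= g x)%E.

(* v such that liminf_{y -> x, y <> x} (g y - g x - <v, y - x>) / |y - x| >= 0 *)
Definition regular_subdiff (R : realType) (n : nat) (g : 'cV[R]_n -> \bar R)
    (x : 'cV[R]_n) : set 'cV[R]_n :=
  [set v | g x \is a fin_num /\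
    forall e : R, 0 < e ->
      \forall y \near x,
        (g x + (inner v (y - x) - e * enorm (y - x))%R%:E <= g y)%E].

Definition limiting_subdiff (R : realType) (n : nat) (g : 'cV[R]_n -> \bar R)
    (x : 'cV[R]_n) : set 'cV[R]_n :=
  [set v | g x \is a fin_num /\
    exists (xs vs : nat -> 'cV[R]_n),
      [/\ xs @ \oo --> x,
          (fun k => g (xs k)) @ \oo --> g x,
          forall k, regular_subdiff g (xs k) (vs k)
        & vs @ \oo --> v]].

Definition composite (R : realType) (n : nat) (f0 : 'cV[R]_n -> R)
    (f1 : 'cV[R]_n -> \bar R) (x : 'cV[R]_n) : \bar R :=
  ((f0 x)%:E + f1 x)%E.

Definition residual (R : realType) (n m p : nat) (A : 'M[R]_(p, n))
    (B : 'M[R]_(p, m)) (c : 'cV[R]_p) (x : 'cV[R]_n) (z : 'cV[R]_m) :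
    'cV[R]_p :=
  A *m x + B *m z - c.

Definition feasible (R : realType) (n m p : nat) (A : 'M[R]_(p, n))
    (B : 'M[R]_(p, m)) (c : 'cV[R]_p) : Prop :=
  exists (x : 'cV[R]_n) (z : 'cV[R]_m), A *m x + B *m z = c.

Definition stationary (R : realType) (n m p : nat)
    (A : 'M[R]_(p, n)) (B : 'M[R]_(p, m)) (c : 'cV[R]_p)
    (F0 : 'cV[R]_n -> R) (F1 : 'cV[R]_n -> \bar R)
    (H0 : 'cV[R]_m -> R) (H1 : 'cV[R]_m -> \bar R)
    (x : 'cV[R]_n) (z : 'cV[R]_m) (lam : 'cV[R]_p) : Prop :=
  [/\ [set grad F0 x + v - A^T *m lam | v in limiting_subdiff F1 x] 0,
      [set grad H0 z + v - B^T *m lam | v in limiting_subdiff H1 z] 0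
    & A *m x + B *m z = c].

(* P = tau_F I - rho A^T A and, with B in place of A, Q. *)
Definition prox_mx (R : realType) (n p : nat) (tau rho : R)
    (A : 'M[R]_(p, n)) : 'M[R]_n :=
  tau%:M - rho *: (A^T *m A).

Definition minimizer (R : realType) (n : nat) (g : 'cV[R]_n -> \bar R)
    (x : 'cV[R]_n) : Prop :=
  forall y, (g x <= g y)%E.

Definition x_objective (R : realType) (n m p : nat)
    (A : 'M[R]_(p, n)) (B : 'M[R]_(p, m)) (c : 'cV[R]_p)
    (F0 : 'cV[R]_n -> R) (F1 : 'cV[R]_n -> \bar R) (rho beta tauF : R)
    (xk : 'cV[R]_n) (zk : 'cV[R]_m) (lamk : 'cV[R]_p) (x : 'cV[R]_n) : \bar R :=
  ((inner (grad F0 xk) x)%:E + F1 x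
   + (rho / 2 * enorm (residual A B c x zk) ^+ 2
      - inner ((1 - rho * beta) *: lamk) (residual A B c x zk)
      + 1 / 2 * wnorm2 (prox_mx tauF rho A) (x - xk))%R%:E)%E.

Definition z_objective (R : realType) (n m p : nat)
    (A : 'M[R]_(p, n)) (B : 'M[R]_(p, m)) (c : 'cV[R]_p)
    (H0 : 'cV[R]_m -> R) (H1 : 'cV[R]_m -> \bar R) (rho beta tauH : R)
    (xk1 : 'cV[R]_n) (zk : 'cV[R]_m) (lamk : 'cV[R]_p) (z : 'cV[R]_m) :
    \bar R :=
  ((inner (grad H0 zk) z)%:E + H1 z
   + (rho / 2 * enorm (residual A B c xk1 z) ^+ 2
      - inner ((1 - rho * beta) *: lamk) (residual A B c xk1 z)
      + 1 / 2 * wnorm2 (prox_mx tauH rho B) (z - zk))%R%:E)%E.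

Definition ppg_admm (R : realType) (n m p : nat)
    (A : 'M[R]_(p, n)) (B : 'M[R]_(p, m)) (c : 'cV[R]_p)
    (F0 : 'cV[R]_n -> R) (F1 : 'cV[R]_n -> \bar R)
    (H0 : 'cV[R]_m -> R) (H1 : 'cV[R]_m -> \bar R)
    (rho beta tauF tauH : R)
    (x : nat -> 'cV[R]_n) (z : nat -> 'cV[R]_m) (lam : nat -> 'cV[R]_p) :
    Prop :=
  forall k : nat,
    [/\ minimizer (x_objective A B c F0 F1 rho beta tauF (x k) (z k) (lam k))
          (x k.+1),
        minimizer
          (z_objective A B c H0 H1 rho beta tauH (x k.+1) (z k) (lam k))
          (z k.+1)
      & lam k.+1 = (1 - rho * beta) *: lam k
                   - rho *: residual A B c (x k.+1) (z k.+1)].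

Definition lagrangian (R : realType) (n m p : nat)
    (A : 'M[R]_(p, n)) (B : 'M[R]_(p, m)) (c : 'cV[R]_p)
    (F : 'cV[R]_n -> \bar R) (H : 'cV[R]_m -> \bar R) (rho beta : R)
    (x : 'cV[R]_n) (z : 'cV[R]_m) (lam : 'cV[R]_p) : \bar R :=
  (F x + H z
   + (- inner ((1 - rho * beta) *: lam) (residual A B c x z)
      + rho / 2 * enorm (residual A B c x z) ^+ 2)%R%:E)%E.

Definition lyapT (R : realType) (n m p : nat)
    (A : 'M[R]_(p, n)) (B : 'M[R]_(p, m)) (c : 'cV[R]_p)
    (F : 'cV[R]_n -> \bar R) (H : 'cV[R]_m -> \bar R)
    (rho beta tauF tauH : R)
    (x : 'cV[R]_n) (z : 'cV[R]_m) (lam : 'cV[R]_p)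
    (x' : 'cV[R]_n) (z' : 'cV[R]_m) : \bar R :=
  (lagrangian A B c F H rho beta x z lam
   + (1 / 2 * wnorm2 (prox_mx tauF rho A) (x - x')
      + 1 / 2 * wnorm2 (prox_mx tauH rho B) (z - z')
      - beta / 2 * (1 - rho * beta) * enorm lam ^+ 2)%R%:E)%E.

(* P(omega^k) along the iterates, for k >= 1; it also involves lam^{k-1},
   which is not a component of omega^k. The value at k = 0 is junk. *)
Definition lyapP (R : realType) (n m p : nat)
    (A : 'M[R]_(p, n)) (B : 'M[R]_(p, m)) (c : 'cV[R]_p)
    (F : 'cV[R]_n -> \bar R) (H : 'cV[R]_m -> \bar R)
    (rho beta tauF tauH d LF LH : R)
    (x : nat -> 'cV[R]_n) (z : nat -> 'cV[R]_m) (lam : nat -> 'cV[R]_p)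
    (k : nat) : \bar R :=
  (lyapT A B c F H rho beta tauF tauH
     (x k) (z k) (lam k) (x k.-1) (z k.-1)
   + (d * (wnorm2 (LF%:M + prox_mx tauF rho A) (x k - x k.-1)
           + wnorm2 (LH%:M + prox_mx tauH rho B + (2 * rho) *: (B^T *m B))
               (z k - z k.-1)
           + (1 - rho * beta) / rho * enorm (lam k - lam k.-1) ^+ 2))%R%:E)%E.

Definition sufficiently_decreasing (R : realType) (n m p : nat)
    (Pk : nat -> \bar R)
    (x : nat -> 'cV[R]_n) (z : nat -> 'cV[R]_m) (lam : nat -> 'cV[R]_p) :
    Prop :=
  exists a1 a2 a3 : R,
    [/\ 0 <= a1, 0 <= a2, 0 <= a3
      & forall k : nat, (1 <= k)%N ->
          (Pk k.+1 - Pk k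
             <= (- a1 * enorm (x k.+1 - x k) ^+ 2
                 - a2 * enorm (z k.+1 - z k) ^+ 2
                 - a3 * enorm (lam k.+1 - lam k) ^+ 2)%R%:E)%E].

Definition bounded_iterates (R : realType) (n m p : nat)
    (x : nat -> 'cV[R]_n) (z : nat -> 'cV[R]_m) (lam : nat -> 'cV[R]_p) :
    Prop :=
  exists M : R, forall k : nat,
    [/\ enorm (x k) <= M, enorm (z k) <= M & enorm (lam k) <= M].

(* Main.v *)
Require Import Defs.
From HB Require Import structures.
From mathcomp Require Import all_boot all_order all_algebra.
From mathcomp Require Import all_classical all_reals all_analysis.
From mathcomp Require Import ring lra.

Set Implicit Arguments.
Unset Strict Implicit.
Unset Printing Implicit Defensive.

Import Order.TTheory GRing.Theory Num.Theory.
Import numFieldNormedType.Exports.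

Local Open Scope classical_set_scope.
Local Open Scope ring_scope.

(** With [theta = 1 - rho * beta], the quadratic terms of each subproblem add up
    to [tau / 2 * |.|^2], so weak convexity turns the minimizing property of an
    iterate into a variational inequality.  Testing it at the previous iterate,
    together with the descent lemma for the smooth part, bounds the variation of
    [lyapT]; the only positive contribution left is
    [theta * (2 - rho * beta) / (2 * rho) * |dlam|^2].  Adding the inequalities
    of two consecutive steps bounds the variation of the bracket weighted by [d]
    and gains [- 2 * beta * |dlam|^2], which wins by the choice of [d].

    For the lower bound, the multiplier update expresses the residual through
    [lam] and [dlam], and the terms of the Lyapunov function that involve them
    form a quadratic form dominating [eps * |lam|^2] with [eps > 0].  Hence the
    Lyapunov function dominates [F + H + eps * |lam|^2]; coercivity gives
    boundedness and telescoping gives vanishing increments. *)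

(** * Euclidean inner products *)

Section inner_theory.
Context {R : realType} {n : nat}.
Implicit Types (u v w : 'cV[R]_n) (a : R).

Lemma innerC u v : inner u v = inner v u.
Proof. by apply: eq_bigr => i _; rewrite mulrC. Qed.

Lemma innerDl u v w : inner (u + v) w = inner u w + inner v w.
Proof. by rewrite -big_split; apply: eq_bigr => i _; rewrite mxE mulrDl. Qed.

Lemma innerZl a u v : inner (a *: u) v = a * inner u v.
Proof. by rewrite mulr_sumr; apply: eq_bigr => i _; rewrite mxE mulrA. Qed.

Lemma innerNl u v : inner (- u) v = - inner u v.
Proof. by rewrite -scaleN1r innerZl mulN1r. Qed.

Lemma innerDr u v w : inner w (u + v) = inner w u + inner w v.
Proof. by rewrite innerC innerDl !(innerC w). Qed.

Lemma innerZr a u v : inner u (a *: v) = a * inner u v.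
Proof. by rewrite innerC innerZl innerC. Qed.

Lemma innerNr u v : inner u (- v) = - inner u v.
Proof. by rewrite innerC innerNl innerC. Qed.

Lemma inner0l v : inner 0 v = 0.
Proof. by rewrite -[0](scale0r 0) innerZl mul0r. Qed.

Definition innerE :=
  (innerDl, innerDr, innerNl, innerNr, innerZl, innerZr).

Lemma inner_ge0 u : 0 <= inner u u.
Proof. by apply: sumr_ge0 => i _; rewrite -expr2 sqr_ge0. Qed.

Lemma enorm_sqr u : enorm u ^+ 2 = inner u u.
Proof. by rewrite sqr_sqrtr // inner_ge0. Qed.

Lemma enorm_ge0 u : 0 <= enorm u.
Proof. exact: sqrtr_ge0. Qed.

(** Expanding 0 <= |u - a w|^2 gives this weighted Young inequality straight from the squared bound,
    without Cauchy-Schwarz. *)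
Lemma inner_young (a : R) u v : 0 < a ->
  inner u u <= a ^+ 2 * inner v v -> forall w,
  2 * inner u w <= a * (inner v v + inner w w).
Proof.
move=> a0 huv w; have := inner_ge0 (u - a *: w).
by rewrite !innerE (innerC w u) => h; rewrite -(ler_pM2l a0); lra.
Qed.

End inner_theory.

Lemma inner_mulmx (R : realType) (n p : nat) (A : 'M[R]_(p, n))
    (u : 'cV[R]_p) (v : 'cV[R]_n) : inner (A^T *m u) v = inner u (A *m v).
Proof.
rewrite /inner (eq_bigr (fun i => \sum_j A j i * u j 0 * v i 0)); last first.
  by move=> i _; rewrite mxE mulr_suml; apply: eq_bigr => j _; rewrite mxE.
rewrite exchange_big /=; apply: eq_bigr => j _.
by rewrite mxE mulr_sumr; apply: eq_bigr => i _; ring.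
Qed.

(** * Derivatives along lines and the descent lemma *)

Lemma derive_inner_grad (R : realType) (n : nat) (f : 'cV[R]_n -> R)
    (x v : 'cV[R]_n) : differentiable f x -> 'D_v f x = inner (grad f x) v.
Proof.
move=> df; rewrite deriveE // {1}[v]matrix_sum_delta linear_sum.
by apply: eq_bigr => i _; rewrite big_ord1 linearZ /= mxE deriveE // mulrC.
Qed.

Lemma is_derive_line (R : realType) (n : nat) (f : 'cV[R]_n -> R)
    (x v : 'cV[R]_n) (t : R) : differentiable f (x + t *: v) ->
  is_derive t (1 : R) (fun s => f (x + s *: v)) (inner (grad f (x + t *: v)) v).
Proof.
move=> df; have lineE : (fun h : R => h^-1 *:
      (((fun s : R => f (x + s *: v)) \o shift t) (h *: 1) - f (x + t *: v))) =
    (fun h => h^-1 *: ((f \o shift (x + t *: v)) (h *: v) - f (x + t *: v))).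
  apply/funext => h /=; congr (_ *: (f _ - _)).
  by rewrite [h *: 1]mulr1 scalerDl addrCA.
split; first by rewrite /derivable lineE; exact: diff_derivable.
by rewrite /derive lineE -derive_inner_grad.
Qed.

Lemma lipschitz_gradient_sqr (R : realType) (n : nat) (f : 'cV[R]_n -> R)
    (L : R) : 0 <= L -> lipschitz_gradient f L -> forall x y,
  inner (grad f x - grad f y) (grad f x - grad f y)
    <= L ^+ 2 * inner (x - y) (x - y).
Proof.
move=> L0 [_ hL] x y; rewrite -!enorm_sqr -exprMn.
by rewrite lerXn2r ?nnegrE ?mulr_ge0 ?enorm_ge0.
Qed.

(** The mean value theorem on [0, 1] replaces integration of the gradient: subtracting the quadratic
    bound from [f] along the segment leaves a function with nonpositive derivative on ]0, 1[. *)
Lemma descent_lemma (R : realType) (n : nat) (f : 'cV[R]_n -> R) (L : R) :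
  0 < L -> lipschitz_gradient f L -> forall x v,
  f (x + v) <= f x + inner (grad f x) v + L / 2 * inner v v.
Proof.
move=> L0 hL x v; set c := inner (grad f x) v; set K := L / 2 * inner v v.
pose h t := f (x + t *: v) - (c * t + K * t ^+ 2).
pose dh t := inner (grad f (x + t *: v)) v - (c + K * (2 * t)).
have hdh t : is_derive t (1 : R) h (dh t).
  have := is_derive_line (hL.1 (x + t *: v)) => ?.
  by apply: is_derive_eq; rewrite /dh /GRing.scale/=; ring.
have [|t] := @MVT R h dh 0 1 ltr01.
  by apply: derivable_within_continuous => t _; have [] := hdh t.
rewrite in_itv /= => /andP[t0 _]; rewrite subr0 mulr1 => ht.
have := lipschitz_gradient_sqr (ltW L0) hL (x + t *: v) x.
rewrite [x + _]addrC addrK innerZl innerZr => hg.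
have {hg} : inner (grad f (t *: v + x) - grad f x)
    (grad f (t *: v + x) - grad f x) <= (L * t) ^+ 2 * inner v v by lra.
(* Young's inequality with factor L t bounds the product of the gradient change with [v] by L t
   |v|^2. *)
move=> /(inner_young (mulr_gt0 L0 t0))/(_ v); rewrite innerDl innerNl => hy.
have {hy} : dh t <= 0 by rewrite /dh /c /K [x + _]addrC; lra.
by rewrite -ht /h scale1r scale0r addr0; lra.
Qed.

(** * Weak convexity and first-order optimality *)

Lemma weakly_convex_segment (R : realType) (n : nat) (gamma : R)
    (g : 'cV[R]_n -> \bar R) (x v : 'cV[R]_n) (a b t : R) :
  proper_fun g -> weakly_convex gamma g -> g x = a%:E -> g (x + v) = b%:E ->
  0 <= t <= 1 ->
  (g (x + t *: v)%R <=
    (a + t * (b - a) + gamma / 2 * (t * (1 - t)) * inner v v)%R%:E)%E.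
Proof.
move=> [gNy _] [_ gcvx] gx gy t01; have := gcvx (x + v) x t t01.
rewrite gx gy -!EFinD.
have -> : t *: (x + v) + (1 - t) *: x = x + t *: v.
  by rewrite scalerDr scalerBl scale1r addrC addrA subrK.
have := gNy (x + t *: v); case: (g _) => [r||] //= _.
(* Here t |x + v|^2 + (1 - t) |x|^2 - |x + t v|^2 = t (1 - t) |v|^2. *)
by rewrite -EFinD !lee_fin !enorm_sqr !innerE (innerC v x); lra.
Qed.

Lemma affine_ge0_lim (R : realType) (a b : R) :
  (forall t, 0 < t <= 1 -> 0 <= a + t * b) -> 0 <= a.
Proof.
move=> h; rewrite leNgt; apply/negP => a0.
have b0 : 0 < b by have := h 1; lra.
(* An explicit witness instead of a limit: at this t, a + t b = a (b - a) / (2 b - a) < 0. *)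
have t0 : 0 < - a / (2 * b - a) by apply: divr_gt0; lra.
have /h : 0 < - a / (2 * b - a) <= 1.
  by rewrite t0 /= ler_pdivrMr; lra.
have e : - a / (2 * b - a) * (2 * b - a) = - a by rewrite divfK //; lra.
by set t := _ / _ in t0 e *; nra.
Qed.

(** Compare [x] with x + t v, divide by t and let t tend to 0: the slope [l] of [q] survives, the
    curvature [K] does not. This is a first-order condition free of subdifferentials. *)
Lemma weakly_convex_minimizer (R : realType) (n : nat) (gamma : R)
    (g : 'cV[R]_n -> \bar R) (q : 'cV[R]_n -> R) (x v : 'cV[R]_n)
    (a b l K : R) :
  proper_fun g -> weakly_convex gamma g ->
  minimizer (fun y => g y + (q y)%:E)%E x ->
  (forall t, q (x + t *: v) = q x + t * l + t ^+ 2 * K) ->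
  g x = a%:E -> g (x + v) = b%:E ->
  a <= b + l + gamma / 2 * inner v v.
Proof.
move=> gp gw xmin qE gx gy; rewrite -subr_ge0.
apply: (@affine_ge0_lim R _ (K - gamma / 2 * inner v v)) => t /andP[t0 t1].
have t01 : 0 <= t <= 1 by rewrite ltW.
have := weakly_convex_segment gp gw gx gy t01.
have := xmin (x + t *: v); rewrite gx qE; have := gp.1 (x + t *: v).
case: (g _) => [r||] // _; rewrite -!EFinD !lee_fin => h1 h2.
by rewrite -(pmulr_rge0 _ t0); lra.
Qed.

(** * Weighted norms and one proximal step *)

Lemma wnorm2D (R : realType) (n : nat) (M N : 'M[R]_n) (u : 'cV[R]_n) :
  wnorm2 (M + N) u = wnorm2 M u + wnorm2 N u.
Proof. by rewrite /wnorm2 mulmxDl innerDr. Qed.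

Lemma wnorm2_scalar (R : realType) (n : nat) (a : R) (u : 'cV[R]_n) :
  wnorm2 a%:M u = a * inner u u.
Proof. by rewrite /wnorm2 mul_scalar_mx innerZr. Qed.

Lemma wnorm2_gram (R : realType) (n p : nat) (A : 'M[R]_(p, n)) (a : R)
    (u : 'cV[R]_n) :
  wnorm2 (a *: (A^T *m A)) u = a * inner (A *m u) (A *m u).
Proof.
by rewrite /wnorm2 -scalemxAl innerZr -mulmxA innerC inner_mulmx.
Qed.

(** Serves both subproblems: [e] is the part of the residual frozen during the step, [mu] the damped
    multiplier. *)
Definition prox_objective (R : realType) (n p : nat) (A : 'M[R]_(p, n))
    (F0 : 'cV[R]_n -> R) (F1 : 'cV[R]_n -> \bar R) (rho tau : R)
    (xk : 'cV[R]_n) (e mu : 'cV[R]_p) (x : 'cV[R]_n) : \bar R :=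
  ((inner (grad F0 xk) x)%:E + F1 x
   + (rho / 2 * enorm (A *m x + e) ^+ 2 - inner mu (A *m x + e)
      + 1 / 2 * wnorm2 (prox_mx tau rho A) (x - xk))%R%:E)%E.

Definition prox_form (R : realType) (n p : nat) (tau rho : R)
  (A : 'M[R]_(p, n)) (u v : 'cV[R]_n) : R :=
  tau * inner u v - rho * inner (A *m u) (A *m v).

Lemma prox_mxE (R : realType) (n p : nat) (tau rho : R) (A : 'M[R]_(p, n))
    (u : 'cV[R]_n) : wnorm2 (prox_mx tau rho A) u = prox_form tau rho A u u.
Proof.
by rewrite /prox_mx -scaleNr wnorm2D wnorm2_scalar wnorm2_gram mulNr.
Qed.

Section prox_step.
Context {R : realType} {n p : nat}.
Variables (A : 'M[R]_(p, n)) (F0 : 'cV[R]_n -> R) (F1 : 'cV[R]_n -> \bar R).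
Variables (L gamma rho tau : R).
Hypotheses (L0 : 0 < L) (hF0 : lipschitz_gradient F0 L).
Hypotheses (hF1 : proper_fun F1) (hwc : weakly_convex gamma F1).
Implicit Types (x xk u v : 'cV[R]_n) (e mu : 'cV[R]_p).

Local Notation objective := (prox_objective A F0 F1 rho tau).
Local Notation form := (prox_form tau rho A).

Lemma minimizer_fin_num xk e mu x :
  minimizer (objective xk e mu) x -> F1 x \is a fin_num.
Proof.
have [F1Ny [y F1y]] := hF1 => /(_ y); rewrite /prox_objective.
by have [] := (F1Ny x, F1Ny y); move: F1y; case: (F1 x) (F1 y) => [?||] [?||].
Qed.

Lemma prox_variational_ineq xk e mu x v : minimizer (objective xk e mu) x ->
  F1 (x + v) \is a fin_num ->
  fine (F1 x) <= fine (F1 (x + v)) + inner (grad F0 xk) v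
    + inner (rho *: (A *m x + e) - mu) (A *m v) + form (x - xk) v
    + gamma / 2 * inner v v.
Proof.
move=> xmin yfin; have xfin := minimizer_fin_num xmin.
pose q y := inner (grad F0 xk) y + (rho / 2 * enorm (A *m y + e) ^+ 2
  - inner mu (A *m y + e) + 1 / 2 * wnorm2 (prox_mx tau rho A) (y - xk)).
pose l := inner (grad F0 xk) v
    + inner (rho *: (A *m x + e) - mu) (A *m v) + form (x - xk) v.
(* The penalty contributes rho / 2 |A v|^2, which cancels the Gram part of [prox_mx]. *)
pose K := tau / 2 * inner v v.
have qmin : minimizer (fun y => F1 y + (q y)%:E)%E x.
  move=> y; have := xmin y; rewrite /prox_objective !(addeC _ (F1 _)).
  by rewrite -!addeA -!EFinD.
have := @weakly_convex_minimizer _ _ gamma F1 q x v _ _ l K hF1 hwc qmin _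
  (esym (fineK xfin)) (esym (fineK yfin)).
rewrite /l => h; rewrite -!addrA in h *; apply: h => t.
rewrite /q /K !prox_mxE !enorm_sqr /prox_form !mulmxDr !mulmxN -!scalemxAr.
rewrite !innerE (innerC v x) (innerC v xk) (innerC xk x) (innerC e (A *m x)).
rewrite (innerC (A *m v) (A *m x)) (innerC (A *m v) e).
rewrite (innerC (A *m v) (A *m xk)) (innerC (A *m xk) (A *m x)).
by field.
Qed.

(** The direction [- u] leads back to [xk]; adding the descent lemma at [xk] cancels the linearized
    gradient. *)
Lemma prox_descent xk e mu x (u := x - xk) : minimizer (objective xk e mu) x ->
  F1 xk \is a fin_num ->
  F0 x + fine (F1 x) <= F0 xk + fine (F1 xk)
    - inner (rho *: (A *m x + e) - mu) (A *m u) - form u u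
    + (L + gamma) / 2 * inner u u.
Proof.
move=> xmin; have xE : xk = x + - u by rewrite /u opprB addrC subrK.
move=> kfin; have := prox_variational_ineq (v := - u) xmin.
rewrite -xE => /(_ kfin); have := descent_lemma L0 hF0 xk u.
rewrite {1}/u [xk + _]addrC subrK -/u.
rewrite /prox_form mulmxN !innerNl !innerNr.
by set w := inner (_ - mu) _; lra.
Qed.

(* Each of the two variational inequalities is tested at the other iterate; this
   is the monotonicity of the subdifferential up to the weak convexity. *)
Lemma prox_monotone xk e mu x e' mu' x' (u := x - xk) (u' := x' - x)
    (w := rho *: (A *m x + e) - mu) (w' := rho *: (A *m x' + e') - mu') :
  (forall v, 0 <= form v v) ->
  minimizer (objective xk e mu) x -> minimizer (objective x e' mu') x' ->
  2 * inner (w' - w) (A *m u') + form u' u' - form u u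
    <= (L + 2 * gamma) * inner u' u' + L * inner u u.
Proof.
move=> fge0 xmin xmin'.
have [xfin xfin'] := (minimizer_fin_num xmin, minimizer_fin_num xmin').
have xE : x' + - u' = x by rewrite /u' opprB addrC subrK.
have xE' : x + u' = x' by rewrite /u' addrC subrK.
have := prox_variational_ineq (v := - u') xmin'.
have := prox_variational_ineq (v := u') xmin.
rewrite xE xE' -/w -/w' -/u -/u' => /(_ xfin') h1 /(_ xfin) h2.
(* The two steps linearize [F0] at [xk] and at [x]; Young's inequality splits the product of the
   gradient change with [u']. *)
have := inner_young L0 (lipschitz_gradient_sqr (ltW L0) hF0 x xk) (- u').
(* Nonnegativity at [u' - u] bounds the mixed term 2 [form u u'] by [form u u + form u' u']. *)
have := fge0 (u' - u); move: h1 h2; rewrite -/u; clearbody u u' w w'.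
rewrite /prox_form mulmxBr !mulmxN !innerE.
by rewrite (innerC u u') (innerC (A *m u) (A *m u')); lra.
Qed.

End prox_step.

(** * Algebra of the multiplier update *)

Section multiplier_identities.
Context {R : realType} {p : nat}.
Variables (rho beta : R).
Hypothesis rho_gt0 : 0 < rho.
Let rho0 : rho != 0 := lt0r_neq0 rho_gt0.
Let theta := 1 - rho * beta.
Implicit Types (a b l r s : 'cV[R]_p).

(** The terms of [lyapT] in the multiplier and the residual. *)
Definition dual_energy l r : R :=
  - theta * inner l r + rho / 2 * inner r r - beta / 2 * theta * inner l l.

(** With a = A dx and b = B dz, the two products on the right are opposite to those that
    [prox_descent] yields for the two blocks, so they cancel on summation. *)
Lemma dual_energy_step l1 l2 r1 r2 a b :
  r2 = r1 + (a + b) -> l2 = theta *: l1 - rho *: r2 ->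
  dual_energy l2 r2 - dual_energy l1 r1
  = - inner (l2 + rho *: b) a - inner l2 b
    - rho / 2 * inner a a - rho / 2 * inner b b
    + theta * (2 - rho * beta) / (2 * rho) * inner (l2 - l1) (l2 - l1).
Proof.
move=> -> ->; rewrite /dual_energy !innerE (innerC r1 l1) (innerC a l1) (innerC b l1).
rewrite (innerC a r1) (innerC b r1) (innerC b a) /theta.
by field.
Qed.

(** Meant for consecutive multiplier increments and s = A dx + B dz: polarization yields a
    telescoping difference, and 2 - 2 theta = 2 rho beta yields the gain. *)
Lemma dual_increment_step l l' s : l' = theta *: l - rho *: s ->
  - (2 * inner l' s)
  = theta / rho * (inner l' l' - inner l l) + 2 * beta * inner l' l'
    + theta / rho * inner (l' - l) (l' - l).
Proof. by move=> ->; rewrite !innerE (innerC s l) /theta; field. Qed.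

(** Eliminating [r] leaves beta / 2 |l|^2 + theta / rho <l, l - l0> + theta (theta + 2 d) / (2 rho)
    |l - l0|^2. The value of [s] makes the square account exactly for the last two terms. *)
Lemma dual_energy_square d l0 l r (s := theta / (rho * (theta + 2 * d))) :
  theta != 0 -> theta + 2 * d != 0 -> l = theta *: l0 - rho *: r ->
  dual_energy l r + d * (theta / rho * inner (l - l0) (l - l0))
  = (beta - s) / 2 * inner l l
    + 1 / (2 * s) * inner (s *: l + (theta / rho) *: (l - l0))
                          (s *: l + (theta / rho) *: (l - l0)).
Proof.
move=> theta0 D0 lE; have -> : r = rho^-1 *: (theta *: l0 - l).
  by rewrite lE opprB addrC subrK scalerA mulVf // scale1r.
rewrite /dual_energy {lE}.
rewrite !innerE (innerC l0 l) /s.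
have -> : beta = (1 - theta) / rho by rewrite /theta; field.
by clearbody theta; field; rewrite rho0 D0 theta0.
Qed.

Lemma dual_energy_lower_bound d : 0 < rho * beta < 1 ->
  (1 - rho * beta) * (2 - rho * beta) / (4 * (rho * beta)) < d ->
  exists2 eps : R, 0 < eps & forall l0 l r, l = theta *: l0 - rho *: r ->
    eps * inner l l
      <= dual_energy l r + d * (theta / rho * inner (l - l0) (l - l0)).
Proof.
move=> /andP[rb0 rb1]; have rb4 : 0 < 4 * (rho * beta) by lra.
rewrite ltr_pdivrMr // => hd.
have th0 : 0 < theta by rewrite /theta; lra.
have hd' : theta * (1 + theta) < d * (4 * (rho * beta)) by rewrite /theta; lra.
have d0 : 0 < d.
  rewrite -(pmulr_lgt0 _ rb4).
  by apply: lt_trans hd'; rewrite mulr_gt0 //; lra.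
have D0 : 0 < theta + 2 * d by lra.
set s := theta / (rho * (theta + 2 * d)).
have s0 : 0 < s by rewrite !(divr_gt0, mulr_gt0).
exists ((beta - s) / 2) => [|l0 l r lE].
  (* The claim s < beta amounts to theta^2 < 2 d rho beta; [hd'] gives it because theta^2 < theta (1
     + theta) / 2. *)
  rewrite divr_gt0 // subr_gt0 /s ltr_pdivrMr ?mulr_gt0 //.
  have rbE : rho * beta = 1 - theta by rewrite /theta; lra.
  rewrite mulrA (mulrC beta) rbE; rewrite rbE in hd' rb0.
  by have := mulr_gt0 th0 rb0; lra.
rewrite (dual_energy_square _ _ lE) ?gt_eqF // lerDl.
by rewrite mulr_ge0 ?inner_ge0 // divr_ge0 // mulr_ge0 // ltW.
Qed.

End multiplier_identities.

(** * Matrix conditions and vanishing increments *)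

Lemma posdef_ge0 (R : realType) (n : nat) (M : 'M[R]_n) (u : 'cV[R]_n) :
  posdef M -> 0 <= inner u (M *m u).
Proof.
move=> [_ Mpos]; have [->|/Mpos/ltW//] := eqVneq u 0.
by rewrite inner0l.
Qed.

Lemma mx_succ_gram (R : realType) (n p : nat) (A : 'M[R]_(p, n)) (tau a b : R)
    (u : 'cV[R]_n) : mx_succ tau%:M (a *: (A^T *m A) + b%:M) ->
  a * inner (A *m u) (A *m u) + b * inner u u <= tau * inner u u.
Proof.
move=> /(posdef_ge0 u); rewrite opprD -scaleNr -(rmorphN (@scalar_mx R n)).
by rewrite -/(wnorm2 _ _) !wnorm2D !wnorm2_scalar wnorm2_gram; lra.
Qed.

Lemma prox_form_ge0 (R : realType) (n p : nat) (A : 'M[R]_(p, n)) (tau rho : R)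
    (u : 'cV[R]_n) : mx_succ tau%:M (rho *: (A^T *m A)) ->
  0 <= prox_form tau rho A u u.
Proof. by move=> /(posdef_ge0 u) h; rewrite -prox_mxE. Qed.

(** Being monotone and bounded below, [q] converges, so its decrements tend to 0 and squeeze
    [e k ^+ 2]. *)
Lemma cvg0_of_decrease (R : realType) (a m : R) (e q : nat -> R) : 0 < a ->
  (forall k, 0 <= e k) -> (forall k, m <= q k) ->
  (forall k, a * e k ^+ 2 <= q k - q k.+1) -> e @ \oo --> (0 : R).
Proof.
move=> a0 e0 qm qe.
have qcvg : cvgn q.
  apply: nonincreasing_is_cvgn; last by exists m => _ [k _ <-].
  apply/nonincreasing_seqP => k; rewrite -subr_ge0; apply: le_trans (qe k).
  by rewrite mulr_ge0 ?sqr_ge0 // ltW.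
have dcvg : (fun k => a^-1 * (q k - q k.+1)) @ \oo --> (0 : R).
  rewrite -[0](mulr0 a^-1) -(subrr (limn q)).
  apply: cvgM; first exact: cvg_cst.
  by apply: cvgB => //; rewrite cvg_shiftS.
have e2cvg : (fun k => e k ^+ 2) @ \oo --> (0 : R).
  apply: squeeze_cvgr (cvg_cst (0 : R)) dcvg; apply: nearW => k.
  by rewrite sqr_ge0 /= mulrC ler_pdivlMr // mulrC.
have -> : e = (fun k => Num.sqrt (e k ^+ 2)).
  by apply/funext => k; rewrite sqrtr_sqr ger0_norm.
by rewrite -sqrtr0; apply: continuous_cvg => //; exact: sqrt_continuous.
Qed.

(** * The Lyapunov function along the iterates *)

Section ppg_admm_iterates.
Context {R : realType} {n m p : nat}.
Variables (A : 'M[R]_(p, n)) (B : 'M[R]_(p, m)) (c : 'cV[R]_p).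
Variables (F0 : 'cV[R]_n -> R) (F1 : 'cV[R]_n -> \bar R).
Variables (H0 : 'cV[R]_m -> R) (H1 : 'cV[R]_m -> \bar R).
Variables (LF LH gammaF gammaH rho beta tauF tauH d : R).
Variables (x : nat -> 'cV[R]_n) (z : nat -> 'cV[R]_m) (lam : nat -> 'cV[R]_p).
Hypotheses (LF0 : 0 < LF) (LH0 : 0 < LH).
Hypotheses (hF0 : lipschitz_gradient F0 LF) (hH0 : lipschitz_gradient H0 LH).
Hypotheses (hF1 : proper_fun F1) (hH1 : proper_fun H1).
Hypotheses (F1wc : weakly_convex gammaF F1) (H1wc : weakly_convex gammaH H1).
Hypotheses (rho_gt0 : 0 < rho) (rb01 : 0 < rho * beta < 1) (d_gt0 : 0 < d).
Hypothesis htauF : mx_succ tauF%:M ((2 * d * rho) *: (A^T *m A)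
  + ((4 * d + 3) * LF + (4 * d + 1) * gammaF)%:M).
Hypothesis htauH : mx_succ tauH%:M ((8 * d * rho) *: (B^T *m B)
  + ((4 * d + 3) * LH + (4 * d + 1) * gammaH)%:M).
Hypothesis htauF_A : mx_succ tauF%:M (rho *: (A^T *m A)).
Hypothesis htauH_B : mx_succ tauH%:M (rho *: (B^T *m B)).
Hypothesis hiter : ppg_admm A B c F0 F1 H0 H1 rho beta tauF tauH x z lam.

Let theta := 1 - rho * beta.
Let r k := residual A B c (x k) (z k).
Let dx k := x k.+1 - x k.
Let dz k := z k.+1 - z k.
Let dlam k := lam k.+1 - lam k.
Let formA u := prox_form tauF rho A u u.
Let formB u := prox_form tauH rho B u u.

Definition obj_value k : R :=
  F0 (x k) + fine (F1 (x k)) + (H0 (z k) + fine (H1 (z k))).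

(** The bracket that [lyapP] weights by [d]. *)
Definition increment_energy k : R :=
  LF * inner (dx k) (dx k) + formA (dx k)
  + (LH * inner (dz k) (dz k) + formB (dz k)
     + 2 * rho * inner (B *m dz k) (B *m dz k))
  + theta / rho * inner (dlam k) (dlam k).

(* The value of [lyapP] at index [k.+1], where the iterates lie in the
   domains of [F1] and [H1]. *)
Definition lyap_real k : R :=
  obj_value k.+1 + dual_energy rho beta (lam k.+1) (r k.+1)
  + (formA (dx k) + formB (dz k)) / 2 + d * increment_energy k.

Lemma x_step_prox k : minimizer (prox_objective A F0 F1 rho tauF (x k)
  (B *m z k - c) (theta *: lam k)) (x k.+1).
Proof.
have [h _ _] := hiter k => y; have := h y; rewrite /x_objective.
have rE u : residual A B c u (z k) = A *m u + (B *m z k - c).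
  by rewrite /residual addrA.
by rewrite !rE.
Qed.

Lemma z_step_prox k : minimizer (prox_objective B H0 H1 rho tauH (z k)
  (A *m x k.+1 - c) (theta *: lam k)) (z k.+1).
Proof.
have [_ h _] := hiter k => y; have := h y; rewrite /z_objective.
have rE u : residual A B c (x k.+1) u = B *m u + (A *m x k.+1 - c).
  by rewrite /residual -addrA addrCA.
by rewrite !rE.
Qed.

Lemma lamS k : lam k.+1 = theta *: lam k - rho *: r k.+1.
Proof. by have [] := hiter k. Qed.

Lemma F1_fin k : F1 (x k.+1) \is a fin_num.
Proof. exact: minimizer_fin_num (x_step_prox k). Qed.

Lemma H1_fin k : H1 (z k.+1) \is a fin_num.
Proof. exact: minimizer_fin_num (z_step_prox k). Qed.

Lemma lyapP_real k :
  lyapP A B c (composite F0 F1) (composite H0 H1)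
    rho beta tauF tauH d LF LH x z lam k.+1 = (lyap_real k)%:E.
Proof.
rewrite /lyapP /lyapT /lagrangian /composite /=.
rewrite -(fineK (F1_fin k)) -(fineK (H1_fin k)) -!EFinD; congr (_%:E).
rewrite (wnorm2D _ (_ *: _)) !(wnorm2D _%:M (prox_mx _ _ _)) !wnorm2_scalar.
rewrite wnorm2_gram !prox_mxE !enorm_sqr innerZl.
rewrite /lyap_real /obj_value /increment_energy /dual_energy -/(dx k) -/(dz k).
rewrite -/(dlam k) -/(r k.+1) -/theta /formA /formB; field.
exact: lt0r_neq0.
Qed.

(** The x-step still sees [z k] while [lam k.+1] is built from [z k.+1]; this lag costs the term in
    [dz k], absent from the z-step. *)
Lemma x_step_multiplier k :
  rho *: (A *m x k.+1 + (B *m z k - c)) - theta *: lam k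
  = - (lam k.+1 + rho *: (B *m dz k)).
Proof.
rewrite lamS /r /residual /dz mulmxBr.
by apply/colP => i; rewrite !mxE; ring.
Qed.

Lemma z_step_multiplier k :
  rho *: (B *m z k.+1 + (A *m x k.+1 - c)) - theta *: lam k = - lam k.+1.
Proof. by rewrite lamS /r /residual; apply/colP => i; rewrite !mxE; ring. Qed.

Lemma residualS k : r k.+1 = r k + (A *m dx k + B *m dz k).
Proof.
by rewrite /r /residual /dx /dz !mulmxBr; apply/colP => i; rewrite !mxE; ring.
Qed.

Lemma dlamS k :
  dlam k.+1 = theta *: dlam k - rho *: (A *m dx k.+1 + B *m dz k.+1).
Proof.
rewrite /dlam (lamS k.+1) residualS [X in _ - X = _]lamS.
by apply/colP => i; rewrite !mxE; ring.
Qed.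

Let ax k := A *m dx k.
Let bz k := B *m dz k.

Lemma energy_descent k :
  obj_value k.+2 + dual_energy rho beta (lam k.+2) (r k.+2)
  <= obj_value k.+1 + dual_energy rho beta (lam k.+1) (r k.+1)
    - formA (dx k.+1) + (LF + gammaF) / 2 * inner (dx k.+1) (dx k.+1)
    - formB (dz k.+1) + (LH + gammaH) / 2 * inner (dz k.+1) (dz k.+1)
    - rho / 2 * inner (ax k.+1) (ax k.+1) - rho / 2 * inner (bz k.+1) (bz k.+1)
    + theta * (2 - rho * beta) / (2 * rho) * inner (dlam k.+1) (dlam k.+1).
Proof.
(* The test point must lie in the domain of [F1]: [x k.+1] does, the arbitrary [x 0] may not, hence
   the shifted index. *)
have := prox_descent LF0 hF0 hF1 F1wc (x_step_prox k.+1) (F1_fin k).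
have := prox_descent LH0 hH0 hH1 H1wc (z_step_prox k.+1) (H1_fin k).
rewrite x_step_multiplier z_step_multiplier -/(dx _) -/(dz _) -/(ax _) -/(bz _).
have := dual_energy_step rho_gt0 (residualS k.+1) (lamS k.+1).
rewrite -/(dlam _) -/theta -/(ax _) -/(bz _) /obj_value /formA /formB !innerNl.
by lra.
Qed.

(** The monotonicity inequalities of the two blocks add up to -2 <dlam, A dx + B dz>, evaluated by
    [dual_increment_step], plus a mixed product due to the lag in z. *)
Lemma increment_descent k :
  increment_energy k.+1 <= increment_energy k
    + 2 * (LF + gammaF) * inner (dx k.+1) (dx k.+1)
    + 2 * (LH + gammaH) * inner (dz k.+1) (dz k.+1)
    + rho * inner (ax k.+1) (ax k.+1) + 4 * rho * inner (bz k.+1) (bz k.+1)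
    - 2 * beta * inner (dlam k.+1) (dlam k.+1).
Proof.
have := prox_monotone LF0 hF0 hF1 F1wc (fun v => prox_form_ge0 v htauF_A)
  (x_step_prox k) (x_step_prox k.+1).
have := prox_monotone LH0 hH0 hH1 H1wc (fun v => prox_form_ge0 v htauH_B)
  (z_step_prox k) (z_step_prox k.+1).
rewrite !x_step_multiplier !z_step_multiplier -!/(dx _) -!/(dz _) -!/(ax _).
rewrite -!/(bz _) -!/(formA _) -!/(formB _).
have -> : - lam k.+2 - - lam k.+1 = - dlam k.+1.
  by rewrite /dlam opprB opprK addrC.
have -> : - (lam k.+2 + rho *: bz k.+1) - - (lam k.+1 + rho *: bz k)
    = - (dlam k.+1 + rho *: (bz k.+1 - bz k)).
  by rewrite /dlam; apply/colP => i; rewrite !mxE; ring.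
have := dual_increment_step rho_gt0 (dlamS k).
rewrite -/theta /increment_energy -!/(ax _) -!/(bz _).
have : 0 <= theta / rho * inner (dlam k.+1 - dlam k) (dlam k.+1 - dlam k).
  rewrite mulr_ge0 ?inner_ge0 // divr_ge0 ?ltW // subr_gt0.
  by case/andP: rb01.
set D := inner (dlam k.+1 - _) _.
(* For a = [ax k.+1], b = [bz k.+1], b' = [bz k], two squares bound 2 rho <b - b', a> by rho |a|^2 +
   2 rho |b|^2 + 2 rho |b'|^2. The last term is stored in [increment_energy k]; its counterpart at
   [k.+1] raises the coefficient of |b|^2 to 4 rho. *)
have := mulr_ge0 (ltW rho_gt0) (inner_ge0 (ax k.+1 - (bz k.+1 - bz k))).
have := mulr_ge0 (ltW rho_gt0) (inner_ge0 (bz k.+1 + bz k)).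
move: (ax k.+1) (bz k.+1) (bz k) (dlam k.+1) @D => a b b' l D.
rewrite !innerE (innerC b a) (innerC b' a) (innerC b' b).
by lra.
Qed.

Let a3 := 2 * d * beta - theta * (2 - rho * beta) / (2 * rho).

(** Half of each new form survives, and its Gram part cancels the rho / 2 terms of [energy_descent].
    Half of each condition on tau absorbs the other Gram terms, and the gap between 4 d + 3 and 4 d
    + 1 leaves exactly [- LF] and [- LH]. *)
Lemma lyap_real_decrease k :
  lyap_real k.+1 - lyap_real k
  <= - LF * inner (dx k.+1) (dx k.+1) - LH * inner (dz k.+1) (dz k.+1)
     - a3 * inner (dlam k.+1) (dlam k.+1).
Proof.
have := energy_descent k.
have := increment_descent k; rewrite -(ler_pM2l d_gt0).
have := mx_succ_gram (dx k.+1) htauF; have := mx_succ_gram (dz k.+1) htauH.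
have := prox_form_ge0 (dx k) htauF_A; have := prox_form_ge0 (dz k) htauH_B.
rewrite -/(formA _) -/(formB _) -/(ax _) -/(bz _).
rewrite /lyap_real /a3.
have -> : formA (dx k.+1) = tauF * inner (dx k.+1) (dx k.+1)
  - rho * inner (ax k.+1) (ax k.+1) by [].
have -> : formB (dz k.+1) = tauH * inner (dz k.+1) (dz k.+1)
  - rho * inner (bz k.+1) (bz k.+1) by [].
by lra.
Qed.

(** The [dlam] part of the bracket is spent in [dual_energy_lower_bound]; the rest of the bracket is
    nonnegative. *)
Lemma lyap_real_lower_bound :
  (1 - rho * beta) * (2 - rho * beta) / (4 * (rho * beta)) < d ->
  exists2 eps : R, 0 < eps & forall k,
    obj_value k.+1 + eps * inner (lam k.+1) (lam k.+1) <= lyap_real k.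
Proof.
move=> hd; have [eps eps0 heps] :=
  dual_energy_lower_bound (p := p) rho_gt0 rb01 hd.
exists eps => // k; have := heps _ _ _ (lamS k); rewrite -/theta -/(dlam k).
have hA : 0 <= formA (dx k) := prox_form_ge0 _ htauF_A.
have hB : 0 <= formB (dz k) := prox_form_ge0 _ htauH_B.
have : 0 <= d * (LF * inner (dx k) (dx k) + formA (dx k)
  + (LH * inner (dz k) (dz k) + formB (dz k)
     + 2 * rho * inner (B *m dz k) (B *m dz k))).
  apply: (mulr_ge0 (ltW d_gt0)).
  have := mulr_ge0 (ltW LF0) (inner_ge0 (dx k)).
  have := mulr_ge0 (ltW LH0) (inner_ge0 (dz k)).
  by have := mulr_ge0 (ltW rho_gt0) (inner_ge0 (B *m dz k)); lra.
by rewrite /lyap_real /increment_energy; lra.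
Qed.

End ppg_admm_iterates.

(** * Boundedness from coercivity, and the conclusion *)

Lemma coercive_bounded (R : realType) (n : nat) (g : 'cV[R]_n -> \bar R)
    (C : R) (x : nat -> 'cV[R]_n) : coercive g ->
  (forall k, (g (x k.+1) <= C%:E)%E) -> exists M, forall k, enorm (x k) <= M.
Proof.
(* Norm at least [s] would force a value above [C]; the maximum covers the initial point, whose
   value is not controlled. *)
move=> /(_ (C + 1))[s hs] hC; exists (Num.max s (enorm (x 0))).
case=> [|k]; rewrite le_max; first by rewrite lexx orbT.
apply/orP; left; rewrite leNgt; apply/negP => /ltW/hs/le_trans/(_ (hC k)).
by rewrite lee_fin; lra.
Qed.

Lemma enorm_bounded (R : realType) (n : nat) (eps C : R) (u : nat -> 'cV[R]_n) :
  0 < eps -> (forall k, eps * inner (u k.+1) (u k.+1) <= C) ->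
  exists M, forall k, enorm (u k) <= M.
Proof.
move=> eps0 hC; apply: (@coercive_bounded _ _
  (fun v => (eps * inner v v)%:E) C) => [M|k]; last by rewrite lee_fin.
(* Norm at least 1 ensures |v| <= |v|^2. *)
exists (Num.max 1 (M / eps)) => v; rewrite ge_max ler_pdivrMr // => /andP[v1 vM].
rewrite lee_fin -enorm_sqr; apply: le_trans vM _; rewrite mulrC ler_pM2l //.
by rewrite expr2 ler_peMr // enorm_ge0.
Qed.

Theorem proposition4 (R : realType) (n m p : nat)
    (A : 'M[R]_(p, n)) (B : 'M[R]_(p, m)) (c : 'cV[R]_p)
    (F0 : 'cV[R]_n -> R) (F1 : 'cV[R]_n -> \bar R)
    (H0 : 'cV[R]_m -> R) (H1 : 'cV[R]_m -> \bar R)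
    (LF LH gammaF gammaH rho beta tauF tauH d : R)
    (x : nat -> 'cV[R]_n) (z : nat -> 'cV[R]_m) (lam : nat -> 'cV[R]_p)
    (hfeas : feasible A B c)
    (hstat : exists (xs : 'cV[R]_n) (zs : 'cV[R]_m) (ls : 'cV[R]_p),
       stationary A B c F0 F1 H0 H1 xs zs ls)
    (hFbnd : bounded_below (composite F0 F1))
    (hHbnd : bounded_below (composite H0 H1))
    (hFcoer : coercive (composite F0 F1))
    (hHcoer : coercive (composite H0 H1))
    (hLF : 0 < LF) (hLH : 0 < LH)
    (hF0 : lipschitz_gradient F0 LF) (hH0 : lipschitz_gradient H0 LH)
    (hF1proper : proper_fun F1) (hH1proper : proper_fun H1)
    (hF1closed : lower_semicontinuous F1) (hH1closed : lower_semicontinuous H1)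
    (hF1wc : weakly_convex gammaF F1) (hH1wc : weakly_convex gammaH H1)
    (hrho : 0 < rho) (hbeta : 0 < beta) (hrhobeta : 0 < rho * beta < 1)
    (hd : (1 - rho * beta) * (2 - rho * beta) / (4 * (rho * beta)) < d)
    (hd0 : 0 < (1 - rho * beta) * (2 - rho * beta) / (4 * (rho * beta)))
    (htauF : mx_succ tauF%:M
       ((2 * d * rho) *: (A^T *m A)
        + ((4 * d + 3) * LF + (4 * d + 1) * gammaF)%:M))
    (htauH : mx_succ tauH%:M
       ((8 * d * rho) *: (B^T *m B)
        + ((4 * d + 3) * LH + (4 * d + 1) * gammaH)%:M))
    (htauF_A : mx_succ tauF%:M (rho *: (A^T *m A)))
    (htauH_B : mx_succ tauH%:M (rho *: (B^T *m B)))
    (htauF_gamma : gammaF < tauF) (htauH_gamma : gammaH < tauH)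
    (hiter : ppg_admm A B c F0 F1 H0 H1 rho beta tauF tauH x z lam) :
  let Pk := lyapP A B c (composite F0 F1) (composite H0 H1)
              rho beta tauF tauH d LF LH x z lam in
  [/\ bounded_iterates x z lam,
      sufficiently_decreasing Pk x z lam,
      (-oo < ereal_inf [set Pk k.+1 | k in [set: nat]])%E
    & [/\ (fun k => enorm (x k.+1 - x k)) @ \oo --> (0 : R),
          (fun k => enorm (z k.+1 - z k)) @ \oo --> (0 : R)
        & (fun k => enorm (lam k.+1 - lam k)) @ \oo --> (0 : R)]].
Proof.
move=> Pk; have d0 : 0 < d := lt_trans hd0 hd.
pose V := lyap_real A B c F0 F1 H0 H1 LF LH rho beta tauF tauH d x z lam.
have PkV k : Pk k.+1 = (V k)%:E.
  exact: (lyapP_real _ _ _ hF1proper hH1proper hrho hiter).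
set a3 := 2 * d * beta
  - (1 - rho * beta) * (2 - rho * beta) / (2 * rho).
(* After clearing denominators this is the lower bound on [d]. *)
have a3_gt0 : 0 < a3.
  have rb4 : 0 < 4 * (rho * beta) by case/andP: hrhobeta; lra.
  move: hd; rewrite ltr_pdivrMr // => hd'.
  by rewrite subr_gt0 ltr_pdivrMr ?mulr_gt0 //; lra.
have Vdec k : V k.+1 - V k <= - LF * enorm (x k.+2 - x k.+1) ^+ 2
    - LH * enorm (z k.+2 - z k.+1) ^+ 2 - a3 * enorm (lam k.+2 - lam k.+1) ^+ 2.
  rewrite !enorm_sqr; exact: (lyap_real_decrease hLF hLH hF0 hH0 hF1proper
    hH1proper hF1wc hH1wc hrho hrhobeta d0 htauF htauH htauF_A htauH_B hiter).
have Vdecx k : LF * enorm (x k.+2 - x k.+1) ^+ 2 <= V k - V k.+1.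
  have := mulr_ge0 (ltW hLH) (sqr_ge0 (enorm (z k.+2 - z k.+1))).
  have := mulr_ge0 (ltW a3_gt0) (sqr_ge0 (enorm (lam k.+2 - lam k.+1))).
  by have := Vdec k; lra.
have Vdecz k : LH * enorm (z k.+2 - z k.+1) ^+ 2 <= V k - V k.+1.
  have := mulr_ge0 (ltW hLF) (sqr_ge0 (enorm (x k.+2 - x k.+1))).
  have := mulr_ge0 (ltW a3_gt0) (sqr_ge0 (enorm (lam k.+2 - lam k.+1))).
  by have := Vdec k; lra.
have Vdecl k : a3 * enorm (lam k.+2 - lam k.+1) ^+ 2 <= V k - V k.+1.
  have := mulr_ge0 (ltW hLF) (sqr_ge0 (enorm (x k.+2 - x k.+1))).
  by have := mulr_ge0 (ltW hLH) (sqr_ge0 (enorm (z k.+2 - z k.+1))); have := Vdec k; lra.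
have VV0 k : V k <= V 0.
  elim: k => // k; apply: le_trans; rewrite -subr_ge0.
  by apply: le_trans (Vdecx k); rewrite mulr_ge0 ?sqr_ge0 // ltW.
have [eps eps0 Vlow] := lyap_real_lower_bound hLF hLH hrho hrhobeta d0
  htauF_A htauH_B hiter hd.
have [mF hmF] := hFbnd; have [mH hmH] := hHbnd.
have Ffin k : composite F0 F1 (x k.+1) = (F0 (x k.+1) + fine (F1 (x k.+1)))%:E.
  by rewrite /composite EFinD fineK // (F1_fin hF1proper hiter).
have Hfin k : composite H0 H1 (z k.+1) = (H0 (z k.+1) + fine (H1 (z k.+1)))%:E.
  by rewrite /composite EFinD fineK // (H1_fin hH1proper hiter).
(* Three summands, each bounded below, have their sum below [V 0]; hence each is bounded above. *)
have bnd k : [/\ mF <= F0 (x k.+1) + fine (F1 (x k.+1)),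
    mH <= H0 (z k.+1) + fine (H1 (z k.+1)),
    0 <= eps * inner (lam k.+1) (lam k.+1) &
    F0 (x k.+1) + fine (F1 (x k.+1)) + (H0 (z k.+1) + fine (H1 (z k.+1)))
      + eps * inner (lam k.+1) (lam k.+1) <= V k].
  split; [by rewrite -lee_fin -Ffin|by rewrite -lee_fin -Hfin| |exact: Vlow].
  by rewrite mulr_ge0 ?inner_ge0 // ltW.
have Vm k : mF + mH <= V k by have [] := bnd k; lra.
split.
- have [|Mx hMx] := coercive_bounded (C := V 0 - mH) (x := x) hFcoer.
    by move=> k; rewrite Ffin lee_fin; have [] := bnd k; have := VV0 k; lra.
  have [|Mz hMz] := coercive_bounded (C := V 0 - mF) (x := z) hHcoer.
    by move=> k; rewrite Hfin lee_fin; have [] := bnd k; have := VV0 k; lra.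
  have [|Ml hMl] := enorm_bounded (C := V 0 - mF - mH) (u := lam) eps0.
    by move=> k; have [] := bnd k; have := VV0 k; lra.
  exists (Num.max Mx (Num.max Mz Ml)) => k.
  by rewrite !le_max hMx hMz hMl !orbT.
- exists LF, LH, a3; split; [exact: ltW..|]; case=> // k _.
  by rewrite !PkV -EFinB lee_fin.
- apply: (@lt_le_trans _ _ (mF + mH)%:E); first exact: ltNyr.
  by apply: le_ereal_inf_tmp => _ [k _ <-]; rewrite PkV lee_fin.
- have cvg_of q (u : nat -> 'cV[R]_q) a : 0 < a ->
      (forall k, a * enorm (u k.+2 - u k.+1) ^+ 2 <= V k - V k.+1) ->
      (fun k => enorm (u k.+1 - u k)) @ \oo --> (0 : R).
    (* The decrease of [V] says nothing of the increment at index 0; shifting the sequence drops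
       it. *)
    move=> a0 hu; rewrite -(cvg_shiftS (fun k => enorm (u k.+1 - u k))).
    by apply: (cvg0_of_decrease a0 _ Vm hu) => k; exact: enorm_ge0.
  by split; [exact: cvg_of Vdecx|exact: cvg_of Vdecz|exact: cvg_of Vdecl].
Qed.
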